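(* Let $T$ be a ring which is not prime and let $R$ be a Noetherian ring which is a maximal subring of $T$ with $(R:T)\neq 0$. If $R$ contains a prime ideal $Q$ of $T$, then either $T$ is Noetherian, or $Q$ is a minimal prime ideal of $T$ (and thus $Q$ is the unique prime ideal of $T$ contained in $R$) with $Q=(R:T)=(R:T)_l$ or $Q=(R:T)=(R:T)_r$. Moreover, if $T$ is neither left Noetherian nor right Noetherian, then $Q=(R:T)=(R:T)_l=(R:T)_r$.
   Context: All rings are associative, unital with $1\neq 0$, and not necessarily commutative; subrings contain the identity of the overring. Noetherian without a side means both left and right Noetherian. A subring $R\subsetneq T$ is a maximal subring of $T$ if there is no subring $S$ with $R\subsetneq S\subsetneq T$. $(R:T):=\{x\in T\mid TxT\subseteq R\}$, $(R:T)_l:=\{x\in T\mid Tx\subseteq R\}$ and $(R:T)_r:=\{x\in T\mid xT\subseteq R\}$ are respectively the largest two-sided, left and right ideal of $T$ contained in $R$. *)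

(* Defs.v *)
From HB Require Import structures.
From mathcomp Require Import all_boot all_order all_algebra.
From mathcomp Require Import boolp classical_sets.

Set Implicit Arguments.
Unset Strict Implicit.
Unset Printing Implicit Defensive.

Import GRing.Theory.
Local Open Scope ring_scope.
Local Open Scope classical_set_scope.

(* Rings are [nzRingType]: associative, unital, 1 != 0, possibly noncommutative.
   Subrings and ideals are arbitrary (classical) subsets [set T]; the ring T
   itself is the subring [setT]. *)

Definition subring (T : nzRingType) (S : set T) : Prop :=
  subring_closed [in S].

Definition maximal_subring (T : nzRingType) (R : set T) : Prop :=
  [/\ subring R, R `<` setT &
      ~ exists S : set T, [/\ subring S, R `<` S & S `<` setT]].

(* [left_ideal S I]: I is a left ideal of the subring S of T, not of T. *)
Definition left_ideal (T : nzRingType) (S I : set T) : Prop :=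
  [/\ I `<=` S, zmod_closed [in I] &
      forall s x : T, S s -> I x -> I (s * x)].

Definition right_ideal (T : nzRingType) (S I : set T) : Prop :=
  [/\ I `<=` S, zmod_closed [in I] &
      forall s x : T, S s -> I x -> I (x * s)].

Definition ideal (T : nzRingType) (S I : set T) : Prop :=
  left_ideal S I /\ right_ideal S I.

Definition ascending_chain_condition (T : Type) (P : set (set T)) : Prop :=
  forall I : nat -> set T,
    (forall n, P (I n)) -> (forall n, I n `<=` I n.+1) ->
    exists n, forall m, (n <= m)%N -> I m = I n.

Definition left_noetherian (T : nzRingType) (S : set T) : Prop :=
  ascending_chain_condition (left_ideal S).

Definition right_noetherian (T : nzRingType) (S : set T) : Prop :=
  ascending_chain_condition (right_ideal S).

Definition noetherian (T : nzRingType) (S : set T) : Prop :=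
  left_noetherian S /\ right_noetherian S.

Definition ideal_prod (T : nzRingType) (A B : set T) : set T :=
  [set x | exists n (a b : 'I_n -> T),
     [/\ forall i, A (a i), forall i, B (b i) & x = \sum_(i < n) a i * b i]].

(* Primeness in the noncommutative (ideal-wise, not completely prime) sense. *)
Definition prime_ideal (T : nzRingType) (P : set T) : Prop :=
  [/\ ideal setT P, P `<` setT &
      forall A B : set T, ideal setT A -> ideal setT B ->
        ideal_prod A B `<=` P -> A `<=` P \/ B `<=` P].

Definition prime_ring (T : nzRingType) : Prop :=
  prime_ideal [set (0 : T)].

Definition minimal_prime (T : nzRingType) (P : set T) : Prop :=
  prime_ideal P /\ ~ exists P' : set T, prime_ideal P' /\ P' `<` P.

(* (R : T), (R : T)_l and (R : T)_r *)
Definition conductor (T : nzRingType) (R : set T) : set T :=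
  [set x | forall s t : T, R (s * x * t)].

Definition lconductor (T : nzRingType) (R : set T) : set T :=
  [set x | forall t : T, R (t * x)].

Definition rconductor (T : nzRingType) (R : set T) : set T :=
  [set x | forall t : T, R (x * t)].

(* Main.v *)
Require Import Defs.
From HB Require Import structures.
From mathcomp Require Import all_boot all_order all_algebra.
From mathcomp Require Import boolp classical_sets.
Import GRing.Theory.
Local Open Scope ring_scope.
Local Open Scope classical_set_scope.

(** Write C, L and L' for the two-sided, left and right conductors of R in T.

    Since R is right Noetherian, the left annihilator of L in T is already the
    annihilator of finitely many elements l_1, ..., l_n of L
    ([finite_lann_lconductor]).  The map t |-> (t l_1, ..., t l_n) sends T to
    R^n, because T l_i lies in R, and its kernel is lann(L).  Hence if lann(L)
    lies in R, then T is an extension of a submodule of R^n by a left ideal of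
    R; as R is left Noetherian, T is a Noetherian left R-module, and in
    particular T is left Noetherian ([left_noetherian_of_lann]).

    Let P be a prime ideal of T contained in R.  Since lann(L) is a two-sided
    ideal of T with lann(L) L = 0, either L is contained in P or lann(L) is, and
    in the second case lann(L) lies in R and T is left Noetherian.  So if T is
    not left Noetherian, then P <= C <= L <= P, that is P = C = L
    ([prime_eq_conductorl]).  Passing to the opposite ring, if T is not right
    Noetherian, then P = C = L' ([prime_eq_conductorr]).  When T is not
    Noetherian one of the two cases applies to every such P; so C is the only
    prime ideal of T contained in R, whence its minimality. *)

(** * Closure properties of classical subsets *)

Lemma zmod_closedP (T : nzRingType) (I : set T) :
  zmod_closed [in I] <-> I 0 /\ forall x y, I x -> I y -> I (x - y).
Proof.
split=> -[I0 IB]; split; first by move: I0; rewrite inE.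
- by move=> x y Ix Iy; have := IB x y; rewrite !inE; apply.
- by rewrite inE.
- by move=> x y; rewrite !inE; apply: IB.
Qed.

Lemma subringP (T : nzRingType) (R : set T) : subring R ->
  [/\ R 1, forall x y, R x -> R y -> R (x - y)
    & forall x y, R x -> R y -> R (x * y)].
Proof.
move=> [R1 RB RM]; split; first by move: R1; rewrite inE.
- by move=> x y Rx Ry; have := RB x y; rewrite !inE; apply.
- by move=> x y Rx Ry; have := RM x y; rewrite !inE; apply.
Qed.

Lemma ideal_setTP (T : nzRingType) (I : set T) :
  ideal setT I <-> [/\ I 0, forall x y, I x -> I y -> I (x - y)
    & forall s x, I x -> I (s * x) /\ I (x * s)].
Proof.
split.
  move=> [[_ /zmod_closedP[I0 IB] IMl] [_ _ IMr]]; split=> // s x Ix.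
  by split; [exact: IMl | exact: IMr].
move=> [I0 IB IM]; have Iz : zmod_closed [in I] by apply/zmod_closedP.
by split; split=> // s x _ /(IM s)[].
Qed.

(** * Chains of left modules over R *)

Lemma chain_sub {X : Type} {I : nat -> set X} :
  (forall n, I n `<=` I n.+1) -> forall m n, (m <= n)%N -> I m `<=` I n.
Proof.
move=> Iinc m n; elim: n => [|n IHn]; first by rewrite leqn0 => /eqP ->.
rewrite leq_eqVlt => /predU1P[-> //|lemn].
exact: subset_trans (IHn lemn) (Iinc n).
Qed.

(** The left R-submodules of T; unlike the left ideals of R, they need not be
    contained in R. *)
Definition left_submodule {T : nzRingType} (R I : set T) : Prop :=
  [/\ I 0, forall x y, I x -> I y -> I (x - y)
    & forall s x, R s -> I x -> I (s * x)].

(** The left annihilator in T of a finite list. *)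
Definition lann_seq {T : nzRingType} (s : seq T) : set T :=
  [set t | forall l, l \in s -> t * l = 0].

(** The induction on [s] is the induction on n for submodules of R^n: one
    coordinate t |-> t l maps the chain to left ideals of R, and its kernel is
    a chain to which the remaining coordinates apply. *)
Lemma left_submodule_chain {T : nzRingType} {R : set T} {s : seq T}
    (I : nat -> set T) :
  left_noetherian R ->
  (forall l, l \in s -> lconductor R l) ->
  (forall n, left_submodule R (I n)) ->
  (forall n, I n `<=` I n.+1) ->
  (forall n, I n `&` lann_seq s `<=` R) ->
  exists n, forall m, (n <= m)%N -> I m = I n.
Proof.
move=> Rnoeth; elim: s I => [|l s IHs] I sL Imod Iinc IR.
  apply: (Rnoeth I) => // n; have [I0 IB IM] := Imod n.
  by split; [move=> x Ix; apply: (IR n); split | apply/zmod_closedP |].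
have [n1 En1] : exists n, forall m, (n <= m)%N ->
    I m `&` [set t | t * l = 0] = I n `&` [set t | t * l = 0].
  apply: (IHs (fun n => I n `&` [set t | t * l = 0])).
  - by move=> l' sl'; apply: sL; rewrite inE sl' orbT.
  - move=> n; have [I0 IB IM] := Imod n; split=>
      [|x y [Ix xl] [Iy yl]|r x Rr [Ix xl]].
    + by split=> //=; rewrite mul0r.
    + by split; [exact: IB | rewrite /= mulrBl xl yl subr0].
    + by split; [exact: IM | rewrite /= -mulrA xl mulr0].
  - by move=> n x [Ix xl]; split=> //; exact: Iinc.
  - move=> n x [[Ix xl] xs]; apply: (IR n); split=> // l'.
    by rewrite inE => /predU1P[-> //|]; exact: xs.
have [n2 En2] : exists n, forall m, (n <= m)%N ->
    [set t * l | t in I m] = [set t * l | t in I n].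
  apply: (Rnoeth (fun n => [set t * l | t in I n])) => n.
    have [I0 IB IM] := Imod n; split.
    + by move=> _ [t _ <-]; apply: sL; rewrite inE eqxx.
    + apply/zmod_closedP; split; first by exists 0 => //; rewrite mul0r.
      move=> _ _ [t It <-] [u Iu <-]; exists (t - u); first exact: IB.
      by rewrite mulrBl.
    + move=> r _ Rr [t It <-]; exists (r * t); first exact: IM.
      by rewrite mulrA.
  by move=> _ [t It <-]; exists t => //; exact: Iinc.
exists (maxn n1 n2) => m; rewrite geq_max => /andP[le1 le2].
(* If t is in I m, then t l = u l for some u in I (maxn n1 n2), and t - u lies in
   the kernel part, which is stationary as well. *)
apply/seteqP; split; last by apply: (chain_sub Iinc); rewrite geq_max le1.
move=> t It.
have : [set t * l | t in I m] (t * l) by exists t.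
rewrite En2 // => -[u Iu ul].
have [_ IBm _] := Imod m; have [_ IB _] := Imod (maxn n1 n2).
have Iu' : I (maxn n1 n2) u by apply: (chain_sub Iinc) Iu; exact: leq_maxr.
have Im_tu : I m (t - u) by apply: IBm => //; exact: (chain_sub Iinc) Iu.
have : (I m `&` [set t | t * l = 0]) (t - u).
  by split=> //=; rewrite mulrBl ul subrr.
rewrite En1 // => -[Itu _].
have Itu' : I (maxn n1 n2) (t - u) by apply: (chain_sub Iinc) Itu; exact: leq_maxl.
have [I0 _ _] := Imod (maxn n1 n2).
have -> : t = t - u - (0 - u) by rewrite sub0r opprK subrK.
by apply: (IB) => //; apply: IB.
Qed.

(** * The annihilator of the left conductor *)

(** The left annihilator in T of (R : T)_l. *)
Definition lann_lconductor {T : nzRingType} (R : set T) : set T :=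
  [set t | forall x, lconductor R x -> t * x = 0].

(** Otherwise there are l_0, l_1, ... in (R : T)_l such that some t_n kills
    l_0, ..., l_(n-1) but not l_n, and the right ideals
    { x in R | lann(l_0, ..., l_(n-1)) x = 0 } of R do not become stationary. *)
Lemma finite_lann_lconductor {T : nzRingType} {R : set T} :
  subring R -> right_noetherian R ->
  exists s : seq T, (forall l, l \in s -> lconductor R l) /\
    lann_seq s `<=` lann_lconductor R.
Proof.
move=> /subringP[R1 RB RM] Rnoeth; apply: contrapT => nofin.
have step (s : seq T) : exists l : T, (forall l, l \in s -> lconductor R l) ->
    lconductor R l /\ exists2 t, lann_seq s t & t * l <> 0.
  apply: contrapT => /forallNP nol; apply: nofin; exists s.
  have sL : forall l, l \in s -> lconductor R l.
    by have /not_implyP[] := nol 0.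
  split=> // t ts x Lx; apply: contrapT => tx.
  by apply: (nol x) => _; split=> //; exists t.
have [f fP] := choice step.
pose s n := iter n (fun s => f s :: s) [::].
have sL n l : l \in s n -> lconductor R l.
  elim: n l => [//|n IHn] l; rewrite /s /= inE => /predU1P[->|/IHn //].
  by have [] := fP _ IHn.
pose J n := [set x | R x /\ forall t, lann_seq (s n) t -> t * x = 0].
have [|n x [Rx xs]|n En] := Rnoeth J.
- move=> n; split; first by move=> x [].
    apply/zmod_closedP; split.
      by split=> [|t _]; rewrite ?mulr0 // -(subrr 1); exact: RB.
    move=> x y [Rx xs] [Ry ys]; split=> [|t ts]; first exact: RB.
    by rewrite mulrBr xs // ys // subrr.
  move=> r x Rr [Rx xs]; split=> [|t ts]; first exact: RM.
  by rewrite mulrA xs // mul0r.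
- split=> // t ts; apply: xs => l sl; apply: ts.
  by rewrite /s /= inE sl orbT.
have [Lf [t ts tf]] := fP (s n) (sL n).
have : J n.+1 (f (s n)).
  split=> [|u us]; first by rewrite -[f _]mul1r; exact: Lf.
  by apply: us; rewrite /s /= inE eqxx.
by rewrite En // => -[_ /(_ t ts)].
Qed.

Lemma left_noetherian_of_lann {T : nzRingType} {R : set T} :
  subring R -> noetherian R -> lann_lconductor R `<=` R ->
  left_noetherian [set: T].
Proof.
move=> Rring [Rl Rr] lannR I Iid Iinc.
have [s [sL slann]] := finite_lann_lconductor Rring Rr.
apply: (left_submodule_chain I Rl sL) => // n.
  have [_ /zmod_closedP[I0 IB] IM] := Iid n.
  by split=> // r x _; exact: IM.
by move=> t [_ ts]; apply/lannR/slann.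
Qed.

(** * Prime ideals contained in R *)

Lemma lann_lconductor_ideal {T : nzRingType} (R : set T) :
  ideal setT (lann_lconductor R).
Proof.
apply/ideal_setTP; split=> [x _|t u tL uL x Lx|r t tL].
- exact: mul0r.
- by rewrite mulrBl tL // uL // subrr.
- split=> x Lx; first by rewrite -mulrA tL // mulr0.
  by rewrite -mulrA tL // => u; rewrite mulrA; exact: Lx.
Qed.

Lemma lconductor_sub_prime {T : nzRingType} {R P : set T} :
  subring R -> noetherian R -> prime_ideal P -> P `<=` R ->
  ~ left_noetherian [set: T] -> lconductor R `<=` P.
Proof.
move=> Rring Rnoeth [/ideal_setTP[P0 PB PM] _ Pprime] PR nTl.
(* The right annihilator of lann(L) is an ideal of T that contains L. *)
pose B := [set x | forall t, lann_lconductor R t -> t * x = 0].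
have /ideal_setTP[_ _ lannM] := lann_lconductor_ideal R.
have Bid : ideal setT B.
  apply/ideal_setTP; split=> [t _|x y xB yB t tL|r x xB].
  - exact: mulr0.
  - by rewrite mulrBr xB // yB // subrr.
  - split=> t tL; last by rewrite mulrA xB // mul0r.
    by rewrite mulrA xB //; have [] := lannM r t tL.
have [|lannP|BP] := Pprime _ _ (lann_lconductor_ideal R) Bid.
- move=> _ [n [a [b [aL bB ->]]]].
  by rewrite big1 // => i _; exact: bB.
- case: nTl; apply: (left_noetherian_of_lann Rring Rnoeth).
  exact: subset_trans lannP PR.
- by move=> x Lx; apply: BP => t; apply.
Qed.

Lemma conductor_sub_lconductor (T : nzRingType) (R : set T) :
  conductor R `<=` lconductor R.
Proof. by move=> x Cx t; rewrite -[t * x]mulr1; exact: Cx. Qed.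

Lemma ideal_sub_conductor {T : nzRingType} {R I : set T} :
  ideal setT I -> I `<=` R -> I `<=` conductor R.
Proof.
move=> /ideal_setTP[_ _ IM] IR x Ix s t; apply: IR.
by have [_] := IM t (s * x) (proj1 (IM s x Ix)).
Qed.

Lemma prime_eq_conductorl {T : nzRingType} {R P : set T} :
  subring R -> noetherian R -> prime_ideal P -> P `<=` R ->
  ~ left_noetherian [set: T] -> P = conductor R /\ conductor R = lconductor R.
Proof.
move=> Rring Rnoeth Pprime PR nTl.
have LP : lconductor R `<=` P by exact: lconductor_sub_prime.
have PC : P `<=` conductor R.
  by case: Pprime => Pid _ _; exact: ideal_sub_conductor.
have CL := @conductor_sub_lconductor T R.
by split; apply/seteqP; split=> // x; [move/CL/LP | move/LP/PC].
Qed.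

(** * The opposite ring *)

Lemma subring_converse {T : nzRingType} {R : set T} :
  subring R -> @subring T^c R.
Proof. by move=> [R1 RB RM]; split=> // x y Rx Ry; exact: RM. Qed.

Lemma ideal_converse (T : nzRingType) (I : set T) :
  @ideal T^c setT I <-> ideal setT I.
Proof. by split=> -[Il Ir]. Qed.

Lemma prime_ideal_converse {T : nzRingType} {P : set T} :
  prime_ideal P -> @prime_ideal T^c P.
Proof.
move=> [Pid PT Pprime]; split=> // [|A B Aid Bid ABP].
  exact/ideal_converse.
have [||x [n [b [a [bB aA ->]]]]|BP|AP] := Pprime B A.
- exact/ideal_converse.
- exact/ideal_converse.
- by apply: ABP; exists n, a, b.
- by right.
- by left.
Qed.

Lemma conductor_converse (T : nzRingType) (R : set T) :
  @conductor T^c R = conductor R.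
Proof.
apply/seteqP; split=> x Cx s t; first by rewrite -mulrA; exact: (Cx t s).
by rewrite -(mulrA (s : T^c)); exact: (Cx t s).
Qed.

Lemma prime_eq_conductorr {T : nzRingType} {R P : set T} :
  subring R -> noetherian R -> prime_ideal P -> P `<=` R ->
  ~ right_noetherian [set: T] -> P = conductor R /\ conductor R = rconductor R.
Proof.
move=> /subring_converse Rring [Rl Rr] /prime_ideal_converse Pprime PR nTr.
have [] := @prime_eq_conductorl T^c R P Rring (conj Rr Rl) Pprime PR nTr.
by rewrite conductor_converse.
Qed.

Theorem proposition4p9 (T : nzRingType) (R Q : set T)
  (T_not_prime : ~ prime_ring T)
  (R_max : maximal_subring R)
  (R_noeth : noetherian R)
  (cond_neq0 : conductor R <> [set 0])
  (Q_prime : prime_ideal Q)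
  (QR : Q `<=` R) :
  (noetherian [set: T]
   \/ [/\ minimal_prime Q,
          forall P : set T, prime_ideal P -> P `<=` R -> P = Q &
          (Q = conductor R /\ conductor R = lconductor R)
          \/ (Q = conductor R /\ conductor R = rconductor R)])
  /\ (~ left_noetherian [set: T] -> ~ right_noetherian [set: T] ->
      [/\ Q = conductor R, conductor R = lconductor R &
          lconductor R = rconductor R]).
Proof.
have [Rring _ _] := R_max.
have primel := @prime_eq_conductorl T R _ Rring R_noeth.
have primer := @prime_eq_conductorr T R _ Rring R_noeth.
split; last first.
  move=> nTl nTr; have [QC CL] := primel Q Q_prime QR nTl.
  have [_ CL'] := primer Q Q_prime QR nTr.
  by split=> //; rewrite -CL.
have [TN|nTN] := pselect (noetherian [set: T]); [by left | right].
have nTlr : ~ left_noetherian [set: T] \/ ~ right_noetherian [set: T].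
  exact/not_andP.
have primeC P : prime_ideal P -> P `<=` R -> P = conductor R.
  by move=> Pp PR; case: nTlr => [/primel|/primer] /(_ P Pp PR)[].
have uniqQ P : prime_ideal P -> P `<=` R -> P = Q.
  by move=> Pp PR; rewrite (primeC P) // (primeC Q).
split=> //.
  split=> // -[P [Pp PQ]]; have /properW PQ' := PQ.
  have EPQ := uniqQ P Pp (subset_trans PQ' QR).
  by move: PQ; rewrite EPQ properEneq => -[/eqP].
by case: nTlr => [/primel|/primer] /(_ Q Q_prime QR); [left | right].
Qed.
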